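(* Let $W:\mathcal{X}\to\mathcal{S}(B)$ be a cq-channel, $\widetilde{\mathcal{X}}=W(\mathcal{X})\subset\mathcal{S}(B)$ and $\sqrt{\widetilde{\mathcal{X}}}=\{\sqrt{\sigma}:\sigma\in\widetilde{\mathcal{X}}\}$. Then for any $\lambda_1,\lambda_2>0$ with $\lambda_1+\lambda_2<1$, \[ \frac14\,\underline{d}_M\!\left(\sqrt{\widetilde{\mathcal{X}}}\right)\le\dot{C}_{\rm DI}(W)\le\liminf_{n\to\infty}\frac{1}{n\log n}\log N_{\rm DI}(n,\lambda_1,\lambda_2)\le\frac12\,\underline{d}_M\!\left(\sqrt{\widetilde{\mathcal{X}}}\right). \]
   Context: A cq-channel is a measurable map $W:\mathcal{X}\to\mathcal{S}(B)$ from a measure space $\mathcal{X}$ to density operators on a finite-dimensional Hilbert space $B$; $W_{x^n}=W_{x_1}\otimes\cdots\otimes W_{x_n}$ for $x^n\in\mathcal{X}^n$. An $(n,N,\lambda_1,\lambda_2)$-DI code for $W$ is a collection $\{(u_j,E_j):j\in[N]\}$ with $u_j\in\mathcal{X}^n$ and operators $0\le E_j\le\mathbb{1}$ on $B^{\otimes n}$ such that for all $j\ne k$: $\operatorname{Tr}W_{u_j}E_j\ge1-\lambda_1$ and $\operatorname{Tr}W_{u_j}E_k\le\lambda_2$. $N_{\rm DI}(n,\lambda_1,\lambda_2)$ is the largest $N$ for which such a code exists. The (pessimistic) slightly superlinear DI capacity is $\dot{C}_{\rm DI}(W)=\inf_{\lambda_1,\lambda_2>0}\liminf_{n\to\infty}\frac{1}{n\log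 n}\log N_{\rm DI}(n,\lambda_1,\lambda_2)$, logs base 2. For a set $F$ of operators on $B$, metrized by the Hilbert–Schmidt norm $\|X\|_2=\sqrt{\operatorname{Tr}X^*X}$, let $\Pi_\delta(F)$ be the maximal number of points of $F$ with pairwise distance at least $\delta$ (equivalently one may use minimal $\delta$-covering numbers); the lower and upper Minkowski dimensions are $\underline{d}_M(F)=\liminf_{\delta\to0}\frac{\log\Pi_\delta(F)}{-\log\delta}$ and $\overline{d}_M(F)=\limsup_{\delta\to0}\frac{\log\Pi_\delta(F)}{-\log\delta}$. *)

(* Defs.v *)
From HB Require Import structures.
From mathcomp Require Import all_boot all_order all_algebra.
From mathcomp Require Import complex mxtens.
From mathcomp Require Import all_classical all_reals all_analysis.

Set Implicit Arguments.
Unset Strict Implicit.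
Unset Printing Implicit Defensive.

Import Order.TTheory GRing.Theory Num.Theory.
Import numFieldNormedType.Exports.
Local Open Scope classical_set_scope.
Local Open Scope ring_scope.

Section QDefs.
Variable R : realType.
Local Notation C := R[i].

Definition adjmx m n (A : 'M[C]_(m, n)) : 'M[C]_(n, m) :=
  \matrix_(i, j) (A j i)^*.

Definition psdmx d (A : 'M[C]_d) : Prop :=
  adjmx A = A /\ forall v : 'cV[C]_d, 0 <= (adjmx v *m A *m v) 0 0.

Definition density d (A : 'M[C]_d) : Prop := psdmx A /\ \tr A = 1.

Definition effect d (E : 'M[C]_d) : Prop := psdmx E /\ psdmx (1%:M - E).

(* PSD square root of a PSD matrix (chosen; unique by the spectral theorem) *)
Definition mxsqrt d (A : 'M[C]_d) : 'M[C]_d :=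
  xget 0 [set S : 'M[C]_d | psdmx S /\ S *m S = A].

Definition hsnorm d (A : 'M[C]_d) : R :=
  Num.sqrt (complex.Re (\tr (adjmx A *m A))).

Definition log2 (x : R) : R := ln x / ln 2.
Definition elog2 (x : \bar R) : \bar R :=
  match x with
  | r%:E => if (0 < r)%R then (log2 r)%:E else -oo
  | +oo => +oo
  | -oo => -oo
  end%E.

Fixpoint chpow (X : Type) (d : nat) (W : X -> 'M[C]_d) (n : nat) :
    ('I_n -> X) -> 'M[C]_(d ^ n) :=
  match n return ('I_n -> X) -> 'M[C]_(d ^ n) with
  | 0 => fun _ => castmx (esym (expn0 d), esym (expn0 d)) 1%:M
  | n'.+1 => fun u =>
      castmx (esym (expnS d n'), esym (expnS d n'))
        (W (u ord0) *t chpow W (fun i : 'I_n' => u (lift ord0 i)))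
  end.

Definition is_DI_code (X : Type) (d : nat) (W : X -> 'M[C]_d) (n N : nat)
    (l1 l2 : R) (u : 'I_N -> ('I_n -> X)) (E : 'I_N -> 'M[C]_(d ^ n)) : Prop :=
  (forall j, effect (E j)) /\
  (forall j, ((1 - l1)%:C)%C <= \tr (chpow W (u j) *m E j)) /\
  (forall j k, j != k -> \tr (chpow W (u j) *m E k) <= (l2%:C)%C).

Definition N_DI (X : Type) (d : nat) (W : X -> 'M[C]_d) (n : nat) (l1 l2 : R)
    : \bar R :=
  ereal_sup [set (N%:R)%:E | N in
    [set N : nat | exists u E, @is_DI_code X d W n N l1 l2 u E]].

Definition DI_rate (X : Type) (d : nat) (W : X -> 'M[C]_d) (l1 l2 : R)
    : \bar R :=
  limn_einf (fun n : nat =>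
    ((n%:R * log2 n%:R)^-1)%:E * elog2 (N_DI W n l1 l2))%E.

Definition C_DI (X : Type) (d : nat) (W : X -> 'M[C]_d) : \bar R :=
  ereal_inf [set DI_rate W l.1 l.2 | l in [set l : R * R | 0 < l.1 /\ 0 < l.2]].

Definition packing d (F : set 'M[C]_d) (delta : R) : \bar R :=
  ereal_sup [set ((size s)%:R)%:E | s in
    [set s : seq 'M[C]_d | uniq s /\ (forall A, A \in s -> F A) /\
       (forall A B, A \in s -> B \in s -> A != B -> delta <= hsnorm (A - B))]].

Definition lower_dimM d (F : set 'M[C]_d) : \bar R :=
  limf_einf (fun delta : R =>
    elog2 (packing F delta) * ((- log2 delta)^-1)%:E)%E ((0 : R)^'+).

End QDefs.

(* Main.v *)
(* For density operators W_x, W_y put f = Tr (sqrt W_x) (sqrt W_y); then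
   |sqrt W_x - sqrt W_y|_2^2 = 2 (1 - f), and f is multiplicative along product
   states, so that the squared distance of the square roots of two product states
   is at most the sum of the letterwise squared distances d_i^2, while their
   overlap is at most exp (- sum_i d_i^2 / 2).

   Converse: two codewords are told apart by an effect, which forces
   sum_i d_i^2 >= kappa, a constant; some letter pair is then at distance at
   least sqrt (kappa / n), and rounding the letters to a maximal packing at half
   that scale is injective on codewords, whence N <= Pi_delta ^ n with
   delta ~ n ^ (-1/2).

   Direct part: test u with the projection E_u onto the eigenvectors of W_u whose
   eigenvalues lie in exp (- H(u) +- K sqrt n) (Chebyshev).  On the windows of u
   and v one has sqrt W_v <= exp ((H(u) - H(v)) / 2 + K sqrt n) sqrt W_u at the
   level of eigenvalues, which bounds Tr W_v E_u by a small term plus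
   exp (O(sqrt n) - sum_i d_i^2 / 2).  A Gilbert-Varshamov code over a packing at
   scale delta ~ n ^ (-1/4), restricted to words of almost equal entropy, makes
   sum_i d_i^2 of order sqrt n with a large constant. *)
Require Import Defs.
From HB Require Import structures.
From mathcomp Require Import all_boot all_order all_algebra.
From mathcomp Require Import complex mxtens.
From mathcomp Require Import all_classical all_reals all_analysis.
From mathcomp Require Import ring lra.
Import Order.TTheory GRing.Theory Num.Theory.
Import numFieldNormedType.Exports.
Set Implicit Arguments.
Unset Strict Implicit.
Unset Printing Implicit Defensive.
Local Open Scope classical_set_scope.
Local Open Scope ring_scope.

(** * Spectral calculus and tensor powers *)

Section LinearAlgebra.
Variable R : realType.
Local Notation C := R[i].

Lemma adjmxE m n (A : 'M[C]_(m, n)) : adjmx A = map_mx Num.conj A^T.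
Proof. by apply/matrixP => i j; rewrite !mxE. Qed.

Lemma adjmxM m n p (A : 'M[C]_(m, n)) (B : 'M[C]_(n, p)) :
  adjmx (A *m B) = adjmx B *m adjmx A.
Proof. by rewrite !adjmxE trmx_mul map_mxM. Qed.

Lemma adjmxK m n (A : 'M[C]_(m, n)) : adjmx (adjmx A) = A.
Proof. by apply/matrixP => i j; rewrite !mxE conjCK. Qed.

Lemma adjmxD m n (A B : 'M[C]_(m, n)) : adjmx (A + B) = adjmx A + adjmx B.
Proof. by apply/matrixP => i j; rewrite !mxE rmorphD. Qed.

Lemma adjmx1 n : adjmx (1%:M : 'M[C]_n) = 1%:M.
Proof. by apply/matrixP => i j; rewrite !mxE rmorph_nat eq_sym. Qed.

Lemma adjmx_tens m n p q (A : 'M[C]_(m, n)) (B : 'M[C]_(p, q)) :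
  adjmx (A *t B) = adjmx A *t adjmx B.
Proof. by rewrite !adjmxE trmx_tens map_mxT. Qed.

Lemma conjC_real (x : R) : ((x%:C)%C : C)^* = (x%:C)%C.
Proof. by apply: conj_Creal; apply/complex_realP; exists x. Qed.

(** Functional calculus in the basis of the columns of [U]: differences and products act pointwise
    on the real function [s]. Unitarity of [U] is a hypothesis of the lemmas that use it. *)
Definition udiag n (U : 'M[C]_n) (s : 'I_n -> R) : 'M[C]_n :=
  U *m diag_mx (\row_i ((s i)%:C)%C) *m adjmx U.

Lemma udiag_mul n (U : 'M[C]_n) s t : adjmx U *m U = 1%:M ->
  udiag U s *m udiag U t = udiag U (fun i => s i * t i).
Proof.
move=> uU; rewrite /udiag -!mulmxA; congr (_ *m _).
rewrite (mulmxA (adjmx U)) uU mul1mx !mulmxA; congr (_ *m _).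
apply/matrixP => i j; rewrite mul_diag_mx !mxE.
by rewrite mulrnAr rmorphM.
Qed.

Lemma tr_udiag n (U : 'M[C]_n) s : adjmx U *m U = 1%:M ->
  \tr (udiag U s) = ((\sum_i s i)%:C)%C.
Proof.
move=> uU; rewrite /udiag mxtrace_mulC mulmxA uU mul1mx.
by rewrite rmorph_sum; apply: eq_bigr => i _; rewrite !mxE eqxx.
Qed.

Lemma udiag1 n (U : 'M[C]_n) : adjmx U *m U = 1%:M ->
  udiag U (fun _ => 1) = 1%:M.
Proof.
move=> uU; rewrite /udiag (_ : diag_mx _ = 1%:M) ?mulmx1 ?(mulmx1C uU) //.
by apply/matrixP => i j; rewrite !mxE.
Qed.

Lemma udiagB n (U : 'M[C]_n) s t :
  udiag U s - udiag U t = udiag U (fun i => s i - t i).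
Proof.
rewrite /udiag -mulmxBl -mulmxBr; congr (_ *m _ *m _).
apply/matrixP => i j; rewrite !mxE rmorphB /=.
by case: (i == j); rewrite ?mulr1n ?mulr0n ?subr0.
Qed.

Lemma udiag_psd n (U : 'M[C]_n) s : (forall i, 0 <= s i) -> psdmx (udiag U s).
Proof.
move=> s0; split.
  rewrite /udiag !adjmxM adjmxK mulmxA; congr (_ *m _ *m _).
  apply/matrixP => i j; rewrite !mxE; case: (eqVneq i j) => [->|ij].
    by rewrite ?eqxx mulr1n conjC_real.
  by rewrite ?[j == i]eq_sym ?(negbTE ij) mulr0n conjC0.
move=> v; rewrite /udiag.
have -> : adjmx v *m (U *m diag_mx (\row_i ((s i)%:C)%C) *m adjmx U) *m v =
  adjmx (adjmx U *m v) *m (diag_mx (\row_i ((s i)%:C)%C) *m (adjmx U *m v)).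
  by rewrite adjmxM adjmxK !mulmxA.
set w := adjmx U *m v; rewrite !mxE; apply: sumr_ge0 => i _.
rewrite mul_diag_mx !mxE mulrCA mulr_ge0 ?ler0c //.
by rewrite mulrC mul_conjC_ge0.
Qed.

(** The spectral theorem for normal matrices yields complex eigenvalues; each is the value of the
    quadratic form at its eigenvector, hence real and nonnegative. *)
Lemma psd_spectral n (A : 'M[C]_n) : psdmx A ->
  exists U s, adjmx U *m U = 1%:M /\ (forall i, 0 <= s i) /\ A = udiag U s.
Proof.
move=> [hA pA].
have nA : A \is normalmx by apply/normalmxP; rewrite -adjmxE hA.
have /orthomx_spectralP eA := nA.
have uP := spectral_unitarymx A.
have PP : spectralmx A *m adjmx (spectralmx A) = 1%:M.
  by rewrite adjmxE; apply/unitarymxP.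
set P := spectralmx A in eA uP PP *; set D := spectral_diag A in eA.
have eA' : A = adjmx P *m diag_mx D *m P.
  by rewrite adjmxE -(invmx_unitary uP).
have eD i : D 0 i = (adjmx (adjmx P *m delta_mx i (0 : 'I_1)) *m A *m
    (adjmx P *m delta_mx i (0 : 'I_1))) 0 0.
  rewrite adjmxM adjmxK {1}eA' -!mulmxA (mulmxA P) PP mul1mx.
  rewrite (mulmxA P) PP mul1mx mul_diag_mx mxE (bigD1 i) //= big1 ?addr0.
    by rewrite !mxE !eqxx mulr1 rmorph1 mul1r.
  by move=> j ji; rewrite !mxE eqxx (negbTE ji) rmorph0 mul0r.
have D0 i : 0 <= D 0 i by rewrite eD; exact: pA.
exists (adjmx P), (fun i => complex.Re (D 0 i)); split.
  by rewrite adjmxK.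
split=> [i|]; first by have := D0 i; rewrite lecE => /andP[].
rewrite /udiag adjmxK {1}eA'; congr (_ *m diag_mx _ *m _).
by apply/rowP => i; rewrite mxE RRe_real // ger0_real.
Qed.

(** [mxsqrt] is a chosen root with default 0, so it suffices to exhibit one root; it takes the
    square roots of the eigenvalues. *)
Lemma mxsqrtP n (A : 'M[C]_n) : psdmx A ->
  psdmx (mxsqrt A) /\ mxsqrt A *m mxsqrt A = A.
Proof.
move=> /psd_spectral[U [s [uU [s0 ->]]]].
suff : exists S, psdmx S /\ S *m S = udiag U s.
  by move=> /(@xgetPex _ 0); rewrite /mxsqrt.
exists (udiag U (fun i => Num.sqrt (s i))); split.
  by apply: udiag_psd => i; exact: sqrtr_ge0.
rewrite udiag_mul //; congr udiag; apply: funext => i.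
by rewrite -expr2 sqr_sqrtr.
Qed.

(* [g i j] is the squared overlap of the i-th column of U with the j-th column of V. *)
Lemma tr_udiag_mul n (U V : 'M[C]_n) :
    adjmx U *m U = 1%:M -> adjmx V *m V = 1%:M ->
  exists g : 'I_n -> 'I_n -> R, (forall i j, 0 <= g i j) /\
    (forall j, \sum_i g i j = 1) /\
    forall s t, \tr (udiag U s *m udiag V t) =
      ((\sum_i \sum_j s i * t j * g i j)%:C)%C.
Proof.
move=> uU uV; pose G := adjmx U *m V.
have gE i j : ((complex.Re (`|G i j| ^+ 2))%:C)%C = G i j * (G i j)^*.
  by rewrite RRe_real ?normCK // ger0_real // mul_conjC_ge0.
exists (fun i j => complex.Re (`|G i j| ^+ 2)); split.
  move=> i j; by rewrite -ler0c gE mul_conjC_ge0.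
split.
  move=> j; apply: (@complexI R); rewrite rmorph_sum rmorph1 /=.
  have : (adjmx G *m G) j j = 1.
    by rewrite /G adjmxM adjmxK mulmxA -(mulmxA _ U) (mulmx1C uU) mulmx1 uV mxE eqxx.
  rewrite mxE => <-; apply: eq_bigr => i _.
  by rewrite gE !mxE mulrC.
move=> s t.
have -> : \tr (udiag U s *m udiag V t) =
    \tr (diag_mx (\row_i ((s i)%:C)%C) *m G *m diag_mx (\row_i ((t i)%:C)%C) *m adjmx G).
  rewrite /udiag /G adjmxM adjmxK -!mulmxA mxtrace_mulC; congr (\tr _).
  by rewrite -!mulmxA.
rewrite rmorph_sum /mxtrace; apply: eq_bigr => i _.
rewrite rmorph_sum mxE; apply: eq_bigr => j _.
rewrite mul_mx_diag mul_diag_mx !rmorphM /= gE; move: (G) => H.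
by rewrite !mxE; ring.
Qed.

(** * Traces and products of tensor powers *)

Lemma mxtrace_cast m n (e : m = n) (A : 'M[C]_m) : \tr (castmx (e, e) A) = \tr A.
Proof. by case: n / e. Qed.

Lemma castmx_mulmx m n (e : m = n) (A B : 'M[C]_m) :
  castmx (e, e) A *m castmx (e, e) B = castmx (e, e) (A *m B).
Proof. by case: n / e. Qed.

Lemma mxtrace_tens m n (A : 'M[C]_m) (B : 'M[C]_n) :
  \tr (A *t B) = \tr A * \tr B.
Proof. by rewrite /mxtrace mulr_sum; apply: eq_bigr => i _; rewrite !mxE. Qed.

Lemma eq_chpow X Y d (S : X -> 'M[C]_d) (T : Y -> 'M[C]_d) n
    (u : 'I_n -> X) (v : 'I_n -> Y) :
  (forall i, S (u i) = T (v i)) -> chpow S u = chpow T v.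
Proof.
elim: n u v => [|n IH] u v H //=.
by rewrite H (IH _ (fun i => v (lift ord0 i))).
Qed.

(** The letterwise products are read as a word over the alphabet ['I_n], spelled by [id], so that
    the result is again a tensor power even when [S] and [T] have different alphabets. *)
Lemma chpow_mul X Y d (S : X -> 'M[C]_d) (T : Y -> 'M[C]_d) n u v :
  chpow S u *m chpow T v = chpow (fun i : 'I_n => S (u i) *m T (v i)) id.
Proof.
elim: n u v => [|n IH] u v /=; first by rewrite castmx_mulmx mulmx1.
by rewrite castmx_mulmx tensmx_mul IH; congr (castmx _ (_ *t _)); apply: eq_chpow.
Qed.

Lemma tr_chpow X d (S : X -> 'M[C]_d) n (u : 'I_n -> X) :
  \tr (chpow S u) = \prod_i \tr (S (u i)).
Proof.
elim: n u => [|n IH] u /=; first by rewrite mxtrace_cast mxtrace1 big_ord0.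
by rewrite mxtrace_cast mxtrace_tens IH big_ord_recl.
Qed.

End LinearAlgebra.

(** * Overlaps of square roots *)

Section Overlap.
Variable R : realType.
Local Notation C := R[i].

Lemma adjmx_chpow X d (S : X -> 'M[C]_d) n (u : 'I_n -> X) :
  (forall x, adjmx (S x) = S x) -> adjmx (chpow S u) = chpow S u.
Proof.
move=> hS; have H m p (e : m = p) (A : 'M[C]_m) :
    adjmx A = A -> adjmx (castmx (e, e) A) = castmx (e, e) A by case: p / e.
elim: n u => [|n IH] u /=; apply: H; first exact: adjmx1.
by rewrite adjmx_tens hS IH.
Qed.

Lemma ReD (z w : C) : complex.Re (z + w) = complex.Re z + complex.Re w.
Proof. by case: z w => [? ?] [? ?]. Qed.

Lemma ReN (z : C) : complex.Re (- z) = - complex.Re z.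
Proof. by case: z. Qed.

Lemma ReZ (a : R) (z : C) : complex.Re ((a%:C)%C * z) = a * complex.Re z.
Proof. by case: z => x y /=; rewrite mul0r subr0. Qed.

Lemma Re_ge0 (z : C) : 0 <= z -> 0 <= complex.Re z.
Proof. by rewrite lecE => /andP[]. Qed.

Lemma psd_tr_ge0 m n (E : 'M[C]_m) (X : 'M[C]_(m, n)) : psdmx E ->
  0 <= \tr (adjmx X *m E *m X).
Proof.
move=> [_ pE]; apply: sumr_ge0 => i _.
have -> : (adjmx X *m E *m X) i i = (adjmx (col i X) *m E *m col i X) 0 0.
  rewrite !mxE; apply: eq_bigr => k _; rewrite !mxE; congr (_ * _).
  by apply: eq_bigr => l _; rewrite !mxE.
exact: pE.
Qed.

(** Real part of the sesquilinear form given by [E]; for the identity it is the real Hilbert-Schmidt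
    inner product. *)
Definition qform m n (E : 'M[C]_m) (X Y : 'M[C]_(m, n)) : R :=
  complex.Re (\tr (adjmx X *m E *m Y)).

Lemma qformDl m n (E : 'M[C]_m) (X Y Z : 'M[C]_(m, n)) :
  qform E (X + Y) Z = qform E X Z + qform E Y Z.
Proof. by rewrite /qform adjmxD !mulmxDl mxtraceD ReD. Qed.

Lemma qformDr m n (E : 'M[C]_m) (X Y Z : 'M[C]_(m, n)) :
  qform E Z (X + Y) = qform E Z X + qform E Z Y.
Proof. by rewrite /qform !mulmxDr mxtraceD ReD. Qed.

Lemma qformZl m n (E : 'M[C]_m) (a : R) (X Y : 'M[C]_(m, n)) :
  qform E ((a%:C)%C *: X) Y = a * qform E X Y.
Proof.
rewrite /qform (_ : adjmx _ = (a%:C)%C *: adjmx X).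
  by rewrite -!scalemxAl mxtraceZ ReZ.
apply/matrixP => i j; rewrite !mxE rmorphM; congr (_ * _). exact: conjC_real.
Qed.

Lemma qformZr m n (E : 'M[C]_m) (a : R) (X Y : 'M[C]_(m, n)) :
  qform E Y ((a%:C)%C *: X) = a * qform E Y X.
Proof. by rewrite /qform -!scalemxAr mxtraceZ ReZ. Qed.

Lemma qformNl m n (E : 'M[C]_m) (X Y : 'M[C]_(m, n)) :
  qform E (- X) Y = - qform E X Y.
Proof. by rewrite -[- X]scaleN1r -(rmorphN1 (real_complex R)) qformZl mulN1r. Qed.

Lemma qformNr m n (E : 'M[C]_m) (X Y : 'M[C]_(m, n)) :
  qform E Y (- X) = - qform E Y X.
Proof. by rewrite -[- X]scaleN1r -(rmorphN1 (real_complex R)) qformZr mulN1r. Qed.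

Definition qformE := (qformDl, qformDr, qformNl, qformNr, qformZl, qformZr).

Lemma qform_ge0 m n (E : 'M[C]_m) (X : 'M[C]_(m, n)) : psdmx E -> 0 <= qform E X X.
Proof. by move=> pE; apply: Re_ge0; exact: psd_tr_ge0. Qed.

Lemma psd1 n : psdmx (1%:M : 'M[C]_n).
Proof.
have u1 : adjmx (1%:M : 'M[C]_n) *m 1%:M = 1%:M by rewrite adjmx1 mulmx1.
by rewrite -(udiag1 u1); apply: udiag_psd.
Qed.

Lemma hsnorm_sqr n (X : 'M[C]_n) : hsnorm X ^+ 2 = qform 1%:M X X.
Proof.
rewrite /hsnorm sqr_sqrtr /qform ?mulmx1 //.
by have := qform_ge0 X (psd1 n); rewrite /qform mulmx1.
Qed.

Lemma qform_effect n (E : 'M[C]_n) (X : 'M[C]_n) : effect E ->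
  qform E X X <= hsnorm X ^+ 2.
Proof.
move=> [_ /(qform_ge0 X)]; rewrite hsnorm_sqr /qform mulmxBr mulmxBl raddfB /=.
by rewrite ReD ReN subr_ge0.
Qed.

Lemma hsnormN n (X : 'M[C]_n) : hsnorm (- X) = hsnorm X.
Proof.
apply/eqP; rewrite -(eqrXn2 (ltn0Sn 1)) ?sqrtr_ge0 //.
by rewrite !hsnorm_sqr !qformE opprK.
Qed.

Lemma hsnorm0 n : hsnorm (0 : 'M[C]_n) = 0.
Proof. by rewrite /hsnorm mulmx0 mxtrace0 sqrtr0. Qed.

(** The parallelogram identity with the square of [X - Y] dropped. *)
Lemma hsnormD_sqr n (X Y : 'M[C]_n) :
  hsnorm (X + Y) ^+ 2 <= 2 * hsnorm X ^+ 2 + 2 * hsnorm Y ^+ 2.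
Proof.
have := qform_ge0 (X - Y) (psd1 n).
rewrite !hsnorm_sqr !qformE.
move: (qform 1%:M X X) (qform 1%:M X Y) (qform 1%:M Y X) (qform 1%:M Y Y) => a b c f.
lra.
Qed.

(* With [q X = Re Tr X E X] and [A = B + D], expand [0 <= q (t B - D)]. *)
Lemma effect_separation n (A B E : 'M[C]_n) (e : R) :
  adjmx A = A -> adjmx B = B -> hsnorm B = 1 -> effect E -> 0 < e ->
  e <= complex.Re (\tr (A *m A *m E)) - complex.Re (\tr (B *m B *m E)) ->
  e / 2 / (1 + 2 / e) <= hsnorm (A - B) ^+ 2.
Proof.
move=> hA hB nB fE e0.
have q2 (X : 'M[C]_n) : adjmx X = X -> complex.Re (\tr (X *m X *m E)) = qform E X X.
  by move=> hX; rewrite /qform hX [in RHS]mxtrace_mulC mulmxA.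
rewrite !q2 //; set D := A - B.
have -> : A = B + D by rewrite addrC subrK.
have := qform_effect D fE; have := qform_effect B fE.
(* With t = e/2 and q B <= 1 the cross terms are at most e/2 + (2/e) q D, which leaves half of the
   gap [e] to be paid by q D. *)
rewrite nB; have := qform_ge0 (((e / 2)%:C)%C *: B - D) fE.1.
have := qform_ge0 B fE.1.
rewrite !qformE; move: (hsnorm D ^+ 2) => z.
move: (qform E B B) (qform E B D) (qform E D B) (qform E D D) => b bd db dd.
clear -e0; move=> h0 h1 h2 h3 h4.
rewrite ler_pdivrMr ?addr_gt0 ?divr_gt0 //.
have -> : z * (1 + 2 / e) = (z * (e / 2 + 1)) / (e / 2) by field; rewrite gt_eqF.
rewrite ler_pdivlMr; [nra | lra].
Qed.

(** In the two eigenbases the overlap is a sum of products of eigenvalues and squared overlaps,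
    hence nonnegative; it is at most 1 because the squared distance is nonnegative. *)
Lemma hsnormB_psd n (A B : 'M[C]_n) : psdmx A -> psdmx B ->
  hsnorm A = 1 -> hsnorm B = 1 ->
  exists2 x : R, 0 <= x <= 1 & \tr (A *m B) = (x%:C)%C /\
     hsnorm (A - B) ^+ 2 = 2 * (1 - x).
Proof.
move=> pA pB nA nB.
have [U [s [uU [s0 eA]]]] := psd_spectral pA.
have [V [t [uV [t0 eB]]]] := psd_spectral pB.
have [g [g0 [_ eg]]] := tr_udiag_mul uU uV.
have := eg s t; rewrite -eA -eB; set x := \sum_i _ => ex.
have x0 : 0 <= x.
  apply: sumr_ge0 => i _; apply: sumr_ge0 => j _.
  by rewrite !mulr_ge0.
have exBA : \tr (B *m A) = (x%:C)%C by rewrite mxtrace_mulC.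
have eAB : hsnorm (A - B) ^+ 2 = 2 * (1 - x).
  rewrite hsnorm_sqr !qformE -!hsnorm_sqr nA nB /qform !mulmx1.
  by rewrite pA.1 pB.1 ex exBA /=; ring.
exists x => //; rewrite x0 /=.
by have := sqr_ge0 (hsnorm (A - B)); rewrite eAB pmulr_rge0 // subr_ge0.
Qed.

Lemma hsnorm_sqrt n (A : 'M[C]_n) : density A -> hsnorm (mxsqrt A) = 1.
Proof.
move=> [/mxsqrtP[[hS _] eS] tA].
by rewrite /hsnorm hS eS tA /= sqrtr1.
Qed.

Lemma hsnorm_chpow X d (S : X -> 'M[C]_d) n (u : 'I_n -> X) :
  (forall x, psdmx (S x)) -> (forall x, hsnorm (S x) = 1) ->
  hsnorm (chpow S u) = 1.
Proof.
move=> pS nS; apply/eqP; rewrite -(eqrXn2 (ltn0Sn 1)) ?sqrtr_ge0 // expr1n.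
rewrite hsnorm_sqr /qform mulmx1 adjmx_chpow; last by move=> x; case: (pS x).
rewrite chpow_mul tr_chpow big1 // => i _.
have [x _ [-> ]] := hsnormB_psd (pS (u i)) (pS (u i)) (nS _) (nS _).
rewrite subrr hsnorm0 expr0n /= => /esym/eqP; rewrite mulf_eq0 pnatr_eq0 /=.
by rewrite subr_eq0 => /eqP <-.
Qed.

(** One factor at a time: 1 - x p = (1 - x) + x (1 - p) <= (1 - x) + (1 - p). *)
Lemma prod_overlap (I : finType) (x : I -> R) : (forall i, 0 <= x i <= 1) ->
  0 <= \prod_i x i <= 1 /\ 1 - \prod_i x i <= \sum_i (1 - x i).
Proof.
move=> hx; elim/big_rec2: _ => [|i s p _ [/andP[p0 p1] hp]]; first by rewrite ler01 subrr lexx.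
have /andP[x0 x1] := hx i; split; nra.
Qed.

(** Both estimates concern the product of the letter overlaps x_i, where d_i^2 = 2 (1 - x_i). The
    first is [prod_overlap]; the second multiplies the inequalities x_i <= exp (x_i - 1). *)
Lemma hsnormB_chpow X d (S : X -> 'M[C]_d) n (u v : 'I_n -> X) :
  (forall x, psdmx (S x)) -> (forall x, hsnorm (S x) = 1) ->
  hsnorm (chpow S u - chpow S v) ^+ 2 <= \sum_i hsnorm (S (u i) - S (v i)) ^+ 2 /\
  complex.Re (\tr (chpow S u *m chpow S v)) <=
    expR (- (\sum_i hsnorm (S (u i) - S (v i)) ^+ 2) / 2).
Proof.
move=> pS nS.
have /choice[x hx] : forall i, exists x : R, 0 <= x <= 1 /\
    \tr (S (u i) *m S (v i)) = (x%:C)%C /\ hsnorm (S (u i) - S (v i)) ^+ 2 = 2 * (1 - x).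
  move=> i; have [x h1 h2] := hsnormB_psd (pS (u i)) (pS (v i)) (nS _) (nS _).
  by exists x.
have eP : \tr (chpow S u *m chpow S v) = ((\prod_i x i)%:C)%C.
  rewrite chpow_mul tr_chpow rmorph_prod; apply: eq_bigr => i _.
  by case: (hx i) => _ [].
have eS : \sum_i hsnorm (S (u i) - S (v i)) ^+ 2 = 2 * \sum_i (1 - x i).
  by rewrite mulr_sumr; apply: eq_bigr => i _; case: (hx i) => _ [].
have [|p01 hp] := @prod_overlap _ x; first by move=> i; case: (hx i).
have hS y : adjmx (S y) = S y by case: (pS y).
split; last first.
  rewrite eP eS /=.
  have -> : - (2 * \sum_i (1 - x i)) / 2 = \sum_i (x i - 1).
    rewrite -mulNr mulrAC (_ : - 2 / 2 = -1) ?mulN1r; last by field.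
    by rewrite -sumrN; apply: eq_bigr => i _; rewrite opprB.
  rewrite expR_sum; apply: ler_prod => i _; case: (hx i) => /andP[-> _] _ /=.
  by have := expR_ge1Dx (x i - 1); rewrite addrC subrK.
rewrite eS.
have -> : hsnorm (chpow S u - chpow S v) ^+ 2 = 2 * (1 - \prod_i x i).
  have n1 := hsnorm_chpow u pS nS; have n2 := hsnorm_chpow v pS nS.
  rewrite hsnorm_sqr !qformE -!hsnorm_sqr n1 n2 /qform !mulmx1 !adjmx_chpow //.
  by rewrite [in \tr (chpow S v *m _)]mxtrace_mulC eP /=; ring.
lra.
Qed.

Lemma DI_code_separation X d (W : X -> 'M[C]_d) n N l1 l2 u E (e : R) j k :
  (forall x, density (W x)) -> e = 1 - l1 - l2 -> 0 < e ->
  @is_DI_code R X d W n N l1 l2 u E -> j != k ->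
  e / 2 / (1 + 2 / e) <= \sum_i hsnorm (mxsqrt (W (u j i)) - mxsqrt (W (u k i))) ^+ 2.
Proof.
move=> HW ee e0 [fE [h1 h2]] jk; pose S x := mxsqrt (W x).
have pS x : psdmx (S x) by case: (mxsqrtP (HW x).1).
have nS x : hsnorm (S x) = 1 by apply: hsnorm_sqrt.
have hS x : adjmx (S x) = S x by case: (pS x).
have [le _] := hsnormB_chpow (u j) (u k) pS nS; apply: le_trans le.
have eW v : chpow W v = chpow S v *m chpow S v :> 'M[C]_(d ^ n).
  by rewrite chpow_mul; apply: eq_chpow => i; case: (mxsqrtP (HW (v i)).1).
apply: (@effect_separation _ _ _ (E j)) => //.
- exact: adjmx_chpow.
- exact: adjmx_chpow.
- exact: hsnorm_chpow.
(* The test [E j] accepts word [j] with probability at least [1 - l1] and word [k] with probability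
   at most [l2]: the gap is at least [e]. *)
- have := h1 j; have := h2 k j; rewrite eq_sym jk => /(_ isT).
  rewrite !eW !lecE /= => /andP[_ +] /andP[_ +]; rewrite ee.
  by move: (complex.Re _) (complex.Re _) => p q; lra.
Qed.

End Overlap.

(** * Typical windows *)

Section Typicality.
Variable R : realType.
Local Notation C := R[i].

(* [A] is the square root of a state; [h] is the entropy (in nats) of that state
   and [v] bounds the variance of its information spectrum. *)
Definition typical m (A : 'M[C]_m) (h v : R) := exists U s,
  [/\ adjmx U *m U = 1%:M, forall i, 0 <= s i, A = udiag U s &
  [/\ \sum_i s i ^+ 2 = 1, \sum_i s i ^+ 2 * (ln (s i ^+ 2) + h) = 0 &
      \sum_i s i ^+ 2 * (ln (s i ^+ 2) + h) ^+ 2 <= v]].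

Lemma udiag_tens m n (U : 'M[C]_m) (V : 'M[C]_n) (s : 'I_m -> R) (t : 'I_n -> R) :
  udiag U s *t udiag V t =
  udiag (U *t V) (fun k => s (mxtens_unindex k).1 * t (mxtens_unindex k).2).
Proof.
rewrite /udiag adjmx_tens -!tensmx_mul; congr (_ *m _ *m _).
apply/matrixP => k l; rewrite -[k]mxtens_unindexK -[l]mxtens_unindexK.
case: (mxtens_unindex k) (mxtens_unindex l) => i j [i' j'].
rewrite tensmxE !mxE !mxtens_indexK /= (can_eq (@mxtens_indexK m n)) xpair_eqE.
case: (i == i'); case: (j == j'); rewrite ?mulr1n ?mulr0n ?mul0r ?mulr0 //.
by rewrite rmorphM.
Qed.

(** The spectrum of a product state is that of two independent variables: entropies add, and so do
    variances, since centring kills the mixed term. *)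
Lemma typical_tens m n (A : 'M[C]_m) (B : 'M[C]_n) h v h' v' :
  typical A h v -> typical B h' v' -> typical (A *t B) (h + h') (v + v').
Proof.
move=> [U [s [uU s0 -> [s1 sh sv]]]] [V [t [uV t0 -> [t1 th tv]]]].
pose a i := ln (s i ^+ 2) + h; pose b j := ln (t j ^+ 2) + h'.
(* Additivity of [ln] can fail at a zero eigenvalue, but there both sides vanish through their
   weight. *)
have lnst i j : (s i * t j) ^+ 2 * (ln ((s i * t j) ^+ 2) + (h + h')) =
    (s i * t j) ^+ 2 * (a i + b j) /\
    (s i * t j) ^+ 2 * (ln ((s i * t j) ^+ 2) + (h + h')) ^+ 2 =
    (s i * t j) ^+ 2 * (a i + b j) ^+ 2.
  have [->|si] := eqVneq (s i) 0; first by rewrite !mul0r expr0n /= !mul0r.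
  have [->|tj] := eqVneq (t j) 0; first by rewrite !mulr0 expr0n /= !mul0r.
  rewrite exprMn lnM ?posrE ?exprn_even_gt0 //.
  by rewrite /a /b; split; ring.
exists (U *t V), (fun k => s (mxtens_unindex k).1 * t (mxtens_unindex k).2); split.
- rewrite adjmx_tens tensmx_mul uU uV.
  apply/matrixP => k l; rewrite -[k]mxtens_unindexK -[l]mxtens_unindexK.
  case: (mxtens_unindex k) (mxtens_unindex l) => i j [i' j'].
  rewrite tensmxE !mxE (can_eq (@mxtens_indexK m n)) xpair_eqE.
  by case: (i == i'); case: (j == j'); rewrite ?mulr1 ?mulr0.
- by move=> k; rewrite mulr_ge0.
- exact: udiag_tens.
split.
- rewrite -[RHS](mulr1 1) -{1}s1 -t1 mulr_sum.
  by apply: eq_bigr => k _; rewrite exprMn.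
- rewrite (_ : \sum_i _ = (\sum_i s i ^+ 2 * a i) * (\sum_j t j ^+ 2) +
    (\sum_i s i ^+ 2) * (\sum_j t j ^+ 2 * b j)).
    by rewrite sh th mul0r mulr0 addr0.
  rewrite !mulr_sum -big_split; apply: eq_bigr => k _.
  by rewrite (lnst _ _).1 /=; ring.
- rewrite (_ : \sum_i _ = (\sum_i s i ^+ 2 * a i ^+ 2) * (\sum_j t j ^+ 2) +
    (\sum_i s i ^+ 2) * (\sum_j t j ^+ 2 * b j ^+ 2) +
    (\sum_i s i ^+ 2 * a i) * (\sum_j (2 * (t j ^+ 2 * b j)))).
    by rewrite sh s1 t1 mul0r mul1r mulr1 addr0 lerD.
  rewrite !mulr_sum -!big_split; apply: eq_bigr => k _.
  by rewrite (lnst _ _).2 /=; ring.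
Qed.

Lemma typical_cast m n (e : m = n) (A : 'M[C]_m) h v :
  typical A h v -> typical (castmx (e, e) A) h v.
Proof. by case: n / e. Qed.

Lemma typical_chpow X d (S : X -> 'M[C]_d) (h : X -> R) v n (u : 'I_n -> X) :
  (forall x, typical (S x) (h x) v) ->
  typical (chpow S u) (\sum_i h (u i)) (v *+ n).
Proof.
move=> tS; elim: n u => [|n IH] u /=; apply: typical_cast.
  rewrite big_ord0; exists 1%:M, (fun=> 1); rewrite udiag1 adjmx1 ?mulmx1 //.
  by split => //; rewrite !big_ord_recl !big_ord0 expr1n ln1 !addr0 mulr0 expr0n mulr0.
by rewrite big_ord_recl mulrS; apply: typical_tens.
Qed.

(** From ln y <= y - 1 at y = 1/s, multiplied by s: - s ln s <= 1 - s. *)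
Lemma entropy_bound (s : R) : 0 <= s <= 1 -> 0 <= - (s * ln s) <= 1.
Proof.
move=> /andP[s0 s1]; rewrite -mulrN mulr_ge0 ?oppr_ge0 ?ln_le0 //=.
have [->|sn] := eqVneq s 0; first by rewrite mul0r.
have sp : 0 < s by rewrite lt_def sn.
have : ln s^-1 <= s^-1 - 1.
  have := @le_ln1Dx _ (s^-1 - 1); rewrite [1 + _]addrC subrK; apply.
  by rewrite ltrBrDr addNr invr_gt0.
rewrite lnV ?posrE // -(ler_pM2l sp) mulrBr mulfV // mulr1 => /le_trans; apply.
by rewrite gerBl.
Qed.

(** The variance is at most the second moment, and s^2 (ln s^2)^2 = 4 (s ln s)^2 <= 4 for each of
    the [d] eigenvalues. The bounds depend on [d] alone and so hold uniformly over the letters. *)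
Lemma typical_density d (A : 'M[C]_d) : density A ->
  exists2 h : R, 0 <= h <= d%:R & typical (mxsqrt A) h (4 * d%:R).
Proof.
move=> [pA tA]; have [pS eS] := mxsqrtP pA.
have [U [s [uU [s0 eU]]]] := psd_spectral pS.
have s1 : \sum_i s i ^+ 2 = 1.
  apply: (@complexI R); rewrite [RHS]rmorph1 -tA -eS eU udiag_mul // tr_udiag //.
have le1 i : s i <= 1.
  rewrite -(@expr_le1 _ 2) // -s1 (bigD1 i) //= lerDl sumr_ge0 // => j _.
  exact: sqr_ge0.
have le1' i : 0 <= s i ^+ 2 <= 1 by rewrite sqr_ge0 exprn_ile1.
have sumd (F : 'I_d -> R) (c : R) : (forall i, F i <= c) -> \sum_i F i <= c * d%:R.
  move=> Fc; apply: (@le_trans _ _ (\sum_(i < d) c)); first exact: ler_sum.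
  by rewrite sumr_const card_ord -[X in X <= _]mulr_natr.
pose h := \sum_i - (s i ^+ 2 * ln (s i ^+ 2)).
exists h.
  apply/andP; split; last rewrite -[X in _ <= X]mul1r.
    by apply: sumr_ge0 => i _; case/andP: (entropy_bound (le1' i)).
  by apply: sumd => i; case/andP: (entropy_bound (le1' i)).
exists U, s; split=> //; split=> //.
  under eq_bigr do rewrite mulrDr.
  by rewrite big_split -mulr_suml s1 mul1r /= /h sumrN subrr.
have hE : \sum_i s i ^+ 2 * ln (s i ^+ 2) = - h by rewrite /h sumrN opprK.
rewrite (_ : \sum_i _ = \sum_i s i ^+ 2 * ln (s i ^+ 2) ^+ 2 +
   (\sum_i s i ^+ 2 * ln (s i ^+ 2)) * (2 * h) + (\sum_i s i ^+ 2) * h ^+ 2); last first.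
  rewrite !mulr_suml -!big_split; apply: eq_bigr => i _ /=; ring.
rewrite s1 hE.
have : \sum_i s i ^+ 2 * ln (s i ^+ 2) ^+ 2 <= 4 * d%:R.
  apply: sumd => i; have /entropy_bound/andP[a b] : 0 <= s i <= 1 by rewrite s0 le1.
  have [->|si] := eqVneq (s i) 0; first by rewrite expr0n mul0r.
  rewrite lnXn ?lt_def ?si ?s0 //.
  rewrite (_ : _ * _ = 4 * (- (s i * ln (s i))) ^+ 2); last by rewrite -mulr_natr; ring.
  by rewrite ler_piMr // exprn_ile1.
have := sqr_ge0 h; lra.
Qed.

(** For p > 0 this says |ln p + h| <= K. The exponential form puts p = 0 outside the window,
    whatever the default value of [ln 0]. *)
Definition window (h K p : R) : bool := expR (- h - K) <= p <= expR (- h + K).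

(** Chebyshev's inequality for the information spectrum: outside the window a positive eigenvalue
    has (ln p + h)^2 >= K^2. *)
Lemma chebyshev_window m (s : 'I_m -> R) h v K : 0 < K ->
  \sum_i s i ^+ 2 * (ln (s i ^+ 2) + h) ^+ 2 <= v ->
  \sum_i s i ^+ 2 * (~~ window h K (s i ^+ 2))%:R <= v / K ^+ 2.
Proof.
move=> K0 hv; rewrite ler_pdivlMr ?exprn_gt0 //; apply: le_trans hv.
rewrite mulr_suml; apply: ler_sum => i _.
have [w|w] := boolP (window _ _ _); first by rewrite mulr0 mul0r mulr_ge0 ?sqr_ge0.
have [s0|sn] := eqVneq (s i) 0; first by rewrite s0 expr0n /= !mul0r.
rewrite -mulrA mul1r ler_wpM2l ?sqr_ge0 //.
have p0 : 0 < s i ^+ 2 by rewrite exprn_even_gt0.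
have [hl|hl] := leP (ln (s i ^+ 2)) (- h + K).
  have [hl'|hl'] := leP (- h - K) (ln (s i ^+ 2)); last by nra.
  case/negP: w; rewrite /window -[s i ^+ 2]lnK ?posrE // !ler_expR hl hl' //.
nra.
Qed.

(* The test projects onto the eigenvectors of [A ^+ 2] whose eigenvalue lies in the window. *)
Lemma typical_test m (A : 'M[C]_m) h v K : typical A h v -> 0 < K ->
  exists E : 'M[C]_m, [/\ effect E, ((1 - v / K ^+ 2)%:C)%C <= \tr (A *m A *m E) &
   forall B h', typical B h' v ->
     \tr (B *m B *m E) <=
     ((v / K ^+ 2 + expR ((h - h') / 2 + K) * complex.Re (\tr (A *m B)))%:C)%C].
Proof.
move=> [U [s [uU s0 -> [s1 _ sv]]]] K0.
pose w i : R := (window h K (s i ^+ 2))%:R.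
exists (udiag U w); split.
- split; first by apply: udiag_psd => i; rewrite ler0n.
  rewrite -(udiag1 uU) udiagB; apply: udiag_psd => i.
  by rewrite subr_ge0 lern1 leq_b1.
- rewrite !udiag_mul // tr_udiag // lecR lerBlDr.
  apply: le_trans (lerD (lexx _) (chebyshev_window K0 sv)).
  rewrite -big_split -[X in X <= _]s1 /=; apply: ler_sum => i _.
  rewrite -expr2 -mulrDr /w; case: window => /=; rewrite ?addr0 ?add0r mulr1 //.
move=> B h' [V [t [uV t0 -> [t1 _ tv]]]].
have [g [g0 [gs eg]]] := tr_udiag_mul uU uV.
rewrite udiag_mul // mxtrace_mulC !eg lecR /=.
apply: le_trans (lerD (chebyshev_window K0 tv) (lexx _)).
(* For each [j] the weights [g i j] sum to 1, so the tail of [B] spreads over pairs of eigenvectors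
   and the bound is checked pair by pair. *)
have -> : \sum_i t i ^+ 2 * (~~ window h' K (t i ^+ 2))%:R =
   \sum_i \sum_j g i j * (t j ^+ 2 * (~~ window h' K (t j ^+ 2))%:R).
  rewrite exchange_big; apply: eq_bigr => j _ /=.
  by rewrite -mulr_suml gs mul1r.
rewrite mulr_sumr -big_split; apply: ler_sum => i _ /=.
rewrite mulr_sumr -big_split; apply: ler_sum => j _ /=.
set M := expR _; have M0 : 0 <= M by exact: expR_ge0.
rewrite mulrC (mulrA M) [M * _ * _]mulrC -mulrDr ler_wpM2l //.
have ts : 0 <= M * (s i * t j) by rewrite !mulr_ge0.
have [w'|w'] := boolP (window h' K _); last first.
  rewrite mulr1 -expr2 /w; case: window; rewrite ?mul1r ?mul0r ?addr_ge0 ?sqr_ge0 //.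
  by rewrite lerDl.
rewrite mulr0 add0r /w; have [ww|ww] := boolP (window _ _ _); last by rewrite mul0r.
(* Both eigenvalues lie in their windows: t^2 <= exp (- h' + K) = M^2 exp (- h - K) <= M^2 s^2,
   hence t <= M s. *)
rewrite mul1r mulrA ler_wpM2r // -(@ler_pXn2r _ 2) ?nnegrE ?mulr_ge0 //.
case/andP: w' => _ /le_trans; apply.
rewrite exprMn; case/andP: ww => /(ler_wpM2l (sqr_ge0 M)) + _.
apply: le_trans; rewrite /M -expRM_natl -expRD ler_expR.
by rewrite le_eqVlt; apply/orP; left; apply/eqP; field.
Qed.

End Typicality.

(** * Construction of codes *)

Section Codes.

(** Gilbert-Varshamov argument: a separated subset that is maximal in [D] covers [D] with the
    [e]-neighbourhoods of its points, each of size at most [K]. *)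
Lemma separated_subset (T : finType) (e : rel T) (D : {set T}) (K : nat) :
  reflexive e -> symmetric e -> (forall x, #|e x| <= K)%N ->
  exists C : {set T}, [/\ C \subset D, (#|D| <= #|C| * K)%N &
    {in C &, forall x y, x != y -> ~~ e x y}].
Proof.
move=> re se hK.
pose P (A : {set T}) := (A \subset D) &&
  [forall x in A, forall y in A, (x != y) ==> ~~ e x y].
have [C /maxsetP[/andP[CD /forall_inP sC] maxC]] : {C | maxset P C}.
  apply: ex_maxset; exists finset.set0; rewrite /P finset.sub0set.
  by apply/forall_inP => x; rewrite inE.
have sep : {in C &, forall x y, x != y -> ~~ e x y}.
  by move=> x y xC yC; have /forall_inP/(_ y yC)/implyP := sC x xC.
exists C; split=> //.
have cov y : y \in D -> (1 <= \sum_(x in C) e x y)%N.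
  move=> yD; rewrite lt0n; apply/eqP => s0.
  have ne x : x \in C -> ~~ e x y.
    move=> xC; apply/negP => exy; move/eqP: s0.
    by rewrite sum_nat_eq0 => /forall_inP/(_ x xC); rewrite exy.
  have yC : y \in C.
    rewrite -(maxC (y |: C)) ?finset.setU11 ?subsetU1 // /P finset.subUset finset.sub1set yD CD /=.
    apply/forall_inP => x; rewrite in_setU1 => /orP[/eqP->|xC];
      apply/forall_inP => z; rewrite in_setU1 => /orP[/eqP->|zC]; apply/implyP => xz.
    - by rewrite eqxx in xz.
    - by rewrite se; exact: ne.
    - exact: ne.
    - exact: sep.
  by have := ne y yC; rewrite re.
rewrite -sum1_card; apply: (@leq_trans (\sum_(y in D) \sum_(x in C) e x y)).
  exact: leq_sum.
rewrite exchange_big /= -sum_nat_const; apply: leq_sum => x xC.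
apply: leq_trans (hK x); rewrite -sum1_card big_mkcond [X in (_ <= X)%N]big_mkcond /=.
by apply: leq_sum => y _; rewrite -[y \in e x]/(e x y); case: (y \in D); case: (e x y).
Qed.

Lemma pigeonhole_fiber (T : finType) B (f : T -> 'I_B.+1) (C : {set T}) :
  exists b, (#|C| <= #|[pred x in C | f x == b]| * B.+1)%N.
Proof.
pose F b := #|[pred x in C | f x == b]|.
have [b _ hb] := @arg_maxnP _ ord0 predT F isT.
exists b; rewrite -sum1_card (partition_big f predT) //=.
rewrite mulnC -[X in (X * _)%N](card_ord B.+1) -sum_nat_const.
apply: leq_sum => c _; apply: leq_trans (hb c isT).
by rewrite /F -sum1_card.
Qed.

(* Generating function: [sum_v M ^ #agreements = (2 M - 1) ^ n]. *)
Lemma card_agreeing_words n M k (w : {ffun 'I_n -> 'I_M}) : (0 < M)%N ->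
  (#|[pred v : {ffun 'I_n -> 'I_M} | (k <= #|[pred i | w i == v i]|)%N]| * M ^ k
    <= (2 * M) ^ n)%N.
Proof.
move=> M0.
apply: (@leq_trans (\sum_(v : {ffun 'I_n -> 'I_M}) M ^ #|[pred i | w i == v i]|)).
  rewrite -sum_nat_const big_mkcond /=; apply: leq_sum => v _.
  by rewrite inE; case: ifP => // kv; rewrite leq_pexp2l.
under eq_bigr => v _ do rewrite -prod_nat_const big_mkcond /=.
rewrite -(bigA_distr_bigA (fun i a => if w i == a then M else 1)%N).
rewrite -[X in (_ <= _ ^ X)%N](card_ord n) -prod_nat_const; apply: leq_prod => i _.
rewrite (bigD1 (w i)) //= eqxx mul2n -addnn leq_add2l.
apply: (@leq_trans (\sum_(a : 'I_M) 1)); last by rewrite sum1_card card_ord.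
rewrite [X in (_ <= X)%N](bigD1 (w i)) //=; apply: leq_trans (leq_addl _ _).
by apply: leq_sum => a; rewrite eq_sym => /negbTE ->.
Qed.

Variable R : realType.
Local Notation C := R[i].

(** Of the M^n words, fixing the integer part of the entropy costs a factor [(n * d).+1], and
    forbidding [k] or more agreements costs (2 M)^n / M^k; about M^k / 2^n words remain up to the
    first factor. Each is tested by its own typical projection. *)
Lemma DI_code_of_packing X d (W : X -> 'M[C]_d) (l1 l2 delta K : R) n k M
    (x : 'I_M -> X) :
  (forall x, density (W x)) -> (0 < M)%N -> 0 < K -> (k <= n)%N ->
  (forall a b, a != b -> delta ^+ 2 <=
     hsnorm (mxsqrt (W (x a)) - mxsqrt (W (x b))) ^+ 2) ->
  (4 * d%:R) *+ n / K ^+ 2 <= l1 ->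
  (4 * d%:R) *+ n / K ^+ 2 +
     expR (1 / 2 + K) * expR (- ((n - k)%:R * delta ^+ 2) / 2) <= l2 ->
  exists N u E, @is_DI_code R X d W n N l1 l2 u E /\
    (M ^ k <= N * (n * d).+1 * 2 ^ n)%N.
Proof.
move=> HW M0 K0 kn sep hl1 hl2; pose S y := mxsqrt (W y).
have pS y : psdmx (S y) by case: (mxsqrtP (HW y).1).
have nS y : hsnorm (S y) = 1 by apply: hsnorm_sqrt.
have /choice[h hh] : forall y, exists h : R, 0 <= h <= d%:R /\ typical (S y) h (4 * d%:R).
  by move=> y; have [h ? ?] := typical_density (HW y); exists h.
pose word (w : {ffun 'I_n -> 'I_M}) i := x (w i).
pose H w := \sum_i h (word w i).
have H0 w : 0 <= H w by apply: sumr_ge0 => i _; have [/andP[]] := hh (word w i).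
have Hd w : H w <= (n * d)%:R.
  have -> : (n * d)%:R = \sum_(i < n) d%:R :> R.
    by rewrite sumr_const card_ord natrM mulr_natl.
  by apply: ler_sum => i _; have [/andP[]] := hh (word w i).
have tW w := typical_chpow (word w) (fun y => (hh y).2).
have /choice[E hE] : forall w, exists E : 'M[C]_(d ^ n), _ := fun w => typical_test (tW w) K0.
(* Entropies in one bin differ by at most 1, which accounts for the term [1 / 2] in the exponent of
   the second error. *)
pose bin w : 'I_(n * d).+1 := inord (Num.truncn (H w)).
have binP w w' : bin w = bin w' -> H w - H w' <= 1.
  move=> /(congr1 val); have lt v : (Num.truncn (H v) < (n * d).+1)%N.
    by rewrite truncn_lt_nat // -natr1 (le_lt_trans (Hd v)) // ltrDl.
  rewrite /= !inordK // => e.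
  have /andP[_] := truncn_itv (H0 w); have /andP[+ _] := truncn_itv (H0 w').
  rewrite e -natr1; lra.
have [b hb] := pigeonhole_fiber bin finset.setT.
pose agree (w v : {ffun 'I_n -> 'I_M}) := (k <= #|[pred i | w i == v i]|)%N.
have [|||D [DC Dcard Dsep]] := @separated_subset _ agree
    [set w | bin w == b]%SET ((2 * M) ^ n %/ M ^ k)%N.
- move=> w; rewrite /agree (leq_trans kn) // -[X in (X <= _)%N](card_ord n).
  by apply: subset_leq_card; apply/fintype.subsetP => i _; rewrite inE eqxx.
- move=> w v; rewrite /agree; congr (_ <= _)%N; apply: eq_card => i.
  by rewrite !inE eq_sym.
- by move=> w; rewrite leq_divRL ?expn_gt0 ?M0 //; apply: card_agreeing_words.
exists #|D|, (fun j => word (enum_val j)), (fun j => E (enum_val j)); split; last first.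
  have Mn : (M ^ n <= #|D| * ((2 * M) ^ n %/ M ^ k) * (n * d).+1)%N.
    have -> : (M ^ n = #|[set: {ffun 'I_n -> 'I_M}]%SET|)%N.
      by rewrite cardsT card_ffun !card_ord.
    apply: leq_trans hb _; rewrite leq_mul2r; apply/orP; right.
    apply: leq_trans Dcard; apply: subset_leq_card.
    by apply/fintype.subsetP => w; rewrite !inE.
  have Mk := leq_divM ((2 * M) ^ n) (M ^ k); rewrite expnMn in Mn Mk.
  rewrite -(@leq_pmul2r (M ^ n)) ?expn_gt0 ?M0 //.
  apply: (@leq_trans (M ^ k * (#|D| * (2 ^ n * M ^ n %/ M ^ k) * (n * d).+1))).
    by rewrite leq_mul2l Mn orbT.
  move: Mk; set q := (_ %/ _)%N => Mk.
  have -> : (M ^ k * (#|D| * q * (n * d).+1) = #|D| * (n * d).+1 * (q * M ^ k))%N by ring.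
  by rewrite -[X in (_ <= X)%N]mulnA leq_mul2l Mk orbT.
have eW v : chpow W v = chpow S v *m chpow S v :> 'M[C]_(d ^ n).
  by rewrite chpow_mul; apply: eq_chpow => i; case: (mxsqrtP (HW (v i)).1).
split; first by move=> j; have [] := hE (enum_val j).
split=> [j|j j' jj'].
  have [_ + _] := hE (enum_val j); rewrite -eW; apply: le_trans.
  by rewrite lecR lerD2l lerN2.
set w := enum_val j; set w' := enum_val j'.
have wD : w \in D by exact: enum_valP.
have w'D : w' \in D by exact: enum_valP.
have ww' : w' != w by apply: contra jj' => /eqP/enum_val_inj ->.
have [_ _ /(_ _ _ (tW w))] := hE w'; rewrite -eW => /le_trans; apply.
rewrite lecR (le_trans _ hl2) // lerD2l.
have binw v : v \in D -> bin v = b by move=> /(fintype.subsetP DC); rewrite inE => /eqP.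
have hH : H w' - H w <= 1 by apply: binP; rewrite !binw.
have [_ ov] := hsnormB_chpow (word w') (word w) pS nS.
apply: (@le_trans _ _ (expR ((H w' - H w) / 2 + K) *
    expR (- ((n - k)%:R * delta ^+ 2) / 2))); last first.
  by apply: ler_wpM2r; rewrite ?expR_ge0 // ler_expR lerD2r; lra.
apply: ler_wpM2l; first exact: expR_ge0.
apply: le_trans ov _; rewrite ler_expR; apply: ler_wpM2r; rewrite ?invr_ge0 // lerN2.
(* Two codewords agree in fewer than [k] letters, so at least [n - k] letters contribute
   [delta ^+ 2] each. *)
pose A := [pred i | w' i != w i].
have cA : (n - k <= #|A|)%N.
  have := Dsep _ _ w'D wD ww'; rewrite /agree -ltnNge => h1.
  rewrite leq_subLR -[X in (X <= _)%N](card_ord n) -(cardC [pred i | w' i == w i]).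
  apply: leq_add; first exact: ltnW.
  by apply: subset_leq_card; apply/fintype.subsetP => i; rewrite !inE.
apply: (@le_trans _ _ (\sum_(i in A) delta ^+ 2)).
  by rewrite sumr_const -[X in _ <= X]mulr_natl ler_wpM2r ?sqr_ge0 // ler_nat.
rewrite [X in _ <= X](bigID (mem A)) /= ler_wpDr //.
  by apply: sumr_ge0 => i _; exact: sqr_ge0.
by apply: ler_sum => i; rewrite inE => wi; exact: sep.
Qed.

End Codes.

(** * Asymptotic rate of the constructed codes *)

Section Rates.
Variable R : realType.
Local Notation C := R[i].

Lemma near_ln_ge (A : R) : \forall n \near \oo, A <= ln n%:R.
Proof.
near=> n; have An : expR A <= n%:R by near: n; exact: nbhs_infty_ger.
by rewrite -(expRK A) ler_ln ?posrE ?expR_gt0 // (lt_le_trans (expR_gt0 A)).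
Unshelve. all: by end_near. Qed.

Lemma near_sqrt_ge (A : R) : \forall n \near \oo, A <= Num.sqrt n%:R.
Proof.
near=> n; have An : A ^+ 2 <= n%:R by near: n; exact: nbhs_infty_ger.
by apply: le_trans (ler_norm A) _; rewrite -sqrtr_sqr ler_sqrt // ler0n.
Unshelve. all: by end_near. Qed.

(** Parameters: window half-width of order sqrt n, delta^2 of order 1 / sqrt n, codewords differing
    in about [theta] n letters. Then - ln delta is (ln n) / 4 up to a constant, the source of the
    factor 1/4, and all other losses in ln N are O(n). *)
Lemma DI_code_rate X d (W : X -> 'M[C]_d) (l1 l2 a theta rho eta : R) :
  (forall x, density (W x)) -> 0 < l1 -> 0 < l2 -> 0 < theta < 1 -> 0 < eta ->
  rho < (1 - theta) * a / 4 ->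
  (forall delta, 0 < delta < eta -> exists M (x : 'I_M -> X),
    [/\ (0 < M)%N, a * - ln delta <= ln M%:R &
      forall i j, i != j -> delta ^+ 2 <=
        hsnorm (mxsqrt (W (x i)) - mxsqrt (W (x j))) ^+ 2]) ->
  \forall n \near \oo, exists N u E, [/\ @is_DI_code R X d W n N l1 l2 u E, (0 < N)%N &
    rho * (n%:R * ln n%:R) <= ln N%:R].
Proof.
move=> HW hl1 hl2 /andP[th0 th1] eta0 hrho hpack.
(* [b] bounds the Chebyshev tail, which may use all of [l1] but only half of [l2]; [kp] makes the
   tail at most [b], and [c2] makes the distance term at least (kp + 1) sqrt n, so that it beats the
   half-width kp sqrt n. *)
pose b := Num.min l1 (l2 / 2).
have b0 : 0 < b by rewrite lt_min hl1 divr_gt0.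
pose kp := 4 * d%:R / b + 1.
have kp1 : 1 <= kp by rewrite lerDr divr_ge0 ?mulr_ge0 // ltW.
pose c2 := 4 * (kp + 1) / theta.
have c20 : 0 < c2 by rewrite divr_gt0 // mulr_gt0 //; lra.
pose g := (1 - theta) * a / 4 - rho.
have g0 : 0 < g by rewrite subr_gt0.
(* [B] collects the losses linear in n; they are absorbed once g ln n >= B. *)
pose B := (1 - theta) * a * ln c2 / 2 + d%:R + 1.
near=> n.
have n0 : (0 < n)%N by near: n; exact: nbhs_infty_gt.
have nR : 0 < n%:R :> R by rewrite ltr0n.
(* Ensures that rounding down [theta * n] keeps at least half of it. *)
have thn : 2 / theta <= n%:R by near: n; exact: nbhs_infty_ger.
have hB : B / g <= ln n%:R by near: n; exact: near_ln_ge.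
(* The second error is at most tail + exp (1/2 - sqrt n), whose last term is thereby at most l2 / 2.
   The next bound puts [delta] below [eta]. *)
have hs2 : 1 / 2 - ln (l2 / 2) <= Num.sqrt n%:R by near: n; exact: near_sqrt_ge.
have hs3 : c2 / eta ^+ 2 + 1 <= Num.sqrt n%:R by near: n; exact: near_sqrt_ge.
set q := Num.sqrt n%:R in hs2 hs3.
have q0 : 0 < q by rewrite sqrtr_gt0.
have qq : q ^+ 2 = n%:R by rewrite sqr_sqrtr // ltW.
pose delta := Num.sqrt (c2 / q).
have d2 : delta ^+ 2 = c2 / q by rewrite sqr_sqrtr // ltW // divr_gt0.
have dl0 : 0 < delta by rewrite sqrtr_gt0 divr_gt0.
have dleta : delta < eta.
  rewrite -(@ltr_pXn2r _ 2) ?nnegrE ?ltW // d2 ltr_pdivrMr // mulrC.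
  by rewrite -ltr_pdivrMr ?exprn_gt0 //; apply: lt_le_trans hs3; rewrite ltrDl.
have [M [x [M0 hM sep]]] := hpack delta (introT andP (conj dl0 dleta)).
pose r := Num.truncn (theta * n%:R).
have /andP[r1 r2] := truncn_itv (mulr_ge0 (ltW th0) (ltW nR)).
rewrite -/r in r1 r2.
have rn : (r <= n)%N.
  by rewrite -(ler_nat R) (le_trans r1) // ler_piMl ?ltW.
have kE : (n - (n - r) = r)%N by rewrite subKn.
have vK : (4 * d%:R) *+ n / (kp * q) ^+ 2 <= b.
  rewrite exprMn qq -mulr_natr -mulf_div divff ?gt_eqF // mulr1.
  rewrite ler_pdivrMr ?exprn_gt0 //; last lra.
  have : 4 * d%:R <= b * kp.
    by rewrite /kp mulrDr mulrCA divff ?gt_eqF // !mulr1 lerDl ltW.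
  move=> /le_trans; apply; rewrite ler_pM2l // expr2 ler_peMl //; lra.
have [||||N [u [E [hcode hN]]]] :=
    @DI_code_of_packing R X d W l1 l2 delta (kp * q) n (n - r) M x HW M0 _ _ sep _ _.
- by rewrite mulr_gt0 //; lra.
- by rewrite leq_subr.
- by apply: le_trans vK _; rewrite ge_min lexx.
- rewrite kE -expRD [l2]splitr; apply: lerD.
    by apply: le_trans vK _; rewrite ge_min lexx orbT.
  rewrite -[X in _ <= X](@lnK _ (l2 / 2)) ?posrE ?divr_gt0 // ler_expR d2.
  suff : (kp + 1) * q <= r%:R * (c2 / q) / 2 by lra.
  have : theta * n%:R / 2 <= r%:R.
    move: r2; rewrite -natr1; move: thn; rewrite ler_pdivrMr // mulrC; lra.
  move=> /(ler_wpM2r (ltW (divr_gt0 c20 q0))).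
  rewrite -qq (_ : theta * q ^+ 2 / 2 * (c2 / q) = 2 * ((kp + 1) * q)); first by lra.
  by rewrite /c2; field; rewrite !gt_eqF.
have N0 : (0 < N)%N.
  by rewrite lt0n; apply: contraTneq hN => ->; rewrite !mul0n -ltnNge expn_gt0 M0.
exists N, u, E; split => //.
have lnM0 : 0 <= ln M%:R :> R by rewrite ln_ge0 // ler1n.
have hk : (1 - theta) * n%:R <= (n - r)%:R by rewrite natrB //; lra.
have hln : (n - r)%:R * ln M%:R <= ln N%:R + n%:R * d%:R + n%:R :> R.
  have : ((M ^ (n - r))%:R : R) <= (N * (n * d).+1 * 2 ^ n)%:R by rewrite ler_nat.
  rewrite -ler_ln ?posrE ?ltr0n ?muln_gt0 ?expn_gt0 ?M0 ?N0 // !natrM !natrX.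
  rewrite !lnM ?posrE ?mulr_gt0 ?exprn_gt0 ?ltr0n // !lnXn ?ltr0n //.
  rewrite -[ln _ *+ (n - r)]mulr_natl -[ln _ *+ n]mulr_natl => /le_trans; apply.
  rewrite -addrA -[X in _ <= X]addrA lerD2l; apply: lerD.
    rewrite -natr1 addrC -natrM; apply: le_ln1Dx.
    by rewrite (lt_le_trans _ (ler0n _ _)) // ltrN10.
  rewrite ler_piMr ?ler0n //.
  have -> : 2%:R = 1 + 1 :> R by rewrite -natr1.
  by apply: le_ln1Dx; lra.
have lnd : - ln delta = ln n%:R / 4 - ln c2 / 2.
  have lnq : ln q * 2 = ln n%:R by rewrite -qq lnXn // mulr_natr.
  have := congr1 (@ln R) d2; rewrite lnXn // lnM ?posrE ?invr_gt0 // lnV ?posrE //.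
  rewrite -[_ *+ 2]mulr_natr; lra.
have h1 : (1 - theta) * n%:R * (a * - ln delta) <= (n - r)%:R * ln M%:R.
  apply: le_trans (_ : (1 - theta) * n%:R * ln M%:R <= _); last exact: ler_wpM2r.
  by apply: ler_wpM2l => //; rewrite mulr_ge0 ?ltW // subr_gt0.
have h2 : (1 - theta) * n%:R * (a * - ln delta) - n%:R * d%:R - n%:R <= ln N%:R by lra.
apply: le_trans h2.
have h3 : 0 <= n%:R * (g * ln n%:R - B).
  by rewrite mulr_ge0 ?ler0n // subr_ge0 -ler_pdivrMl // mulrC.
rewrite -subr_ge0 lnd; apply: le_trans h3 _; rewrite /g /B.
by rewrite le_eqVlt; apply/orP; left; apply/eqP; field.
Unshelve. all: by end_near. Qed.

End Rates.

(** * Packings and the converse *)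

Section Converse.
Variable R : realType.
Local Notation C := R[i].

(** If two codewords rounded to the same word over [s], each letter pair would be at squared
    distance below 4 delta^2, and the total would fall short of the separation forced by the
    code. *)
Lemma DI_code_size X d (W : X -> 'M[C]_d) n N l1 l2 u E (e delta : R) (s : seq 'M[C]_d) :
  (forall x, density (W x)) -> e = 1 - l1 - l2 -> 0 < e -> (0 < n)%N ->
  @is_DI_code R X d W n N l1 l2 u E ->
  4 * delta ^+ 2 * n%:R <= e / 2 / (1 + 2 / e) ->
  (forall x, exists2 A, A \in s & hsnorm (mxsqrt (W x) - A) < delta) ->
  (N <= size s ^ n)%N.
Proof.
move=> HW ee e0 n0 hcode hdelta cover.
have /choice[f hf] : forall x, exists k : 'I_(size s),
    hsnorm (mxsqrt (W x) - nth 0 s k) < delta.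
  move=> x; have [A As hA] := cover x.
  have ks : (index A s < size s)%N by rewrite index_mem.
  by exists (Ordinal ks); rewrite /= nth_index.
pose g j : {ffun 'I_n -> 'I_(size s)} := [ffun i => f (u j i)].
suff /leq_card : injective g by rewrite card_ffun !card_ord.
move=> j k gjk; apply/eqP/negPn/negP => jk.
have := DI_code_separation HW ee e0 hcode jk; rewrite leNgt => /negP; apply.
apply: lt_le_trans hdelta.
rewrite mulr_natr -[in X in _ < X](card_ord n) -sumr_const.
(* Strictness of the sum needs at least one letter, hence [0 < n]. *)
apply: ltr_sum; first by apply/hasP; exists (Ordinal n0); rewrite // mem_index_enum.
move=> i _; have := congr1 (fun h : {ffun _} => h i) gjk; rewrite !ffunE => fjk.
set A := mxsqrt (W (u j i)); set B := mxsqrt (W (u k i)); set P := nth 0 s (f (u j i)).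
have -> : A - B = (A - P) + (P - B) by rewrite addrA subrK.
have lt2 (Y : 'M[C]_d) : hsnorm Y < delta -> hsnorm Y ^+ 2 < delta ^+ 2.
  by move=> h; rewrite ltrXn2r ?sqrtr_ge0.
have /lt2 hA : hsnorm (A - P) < delta by exact: hf.
have /lt2 hB : hsnorm (P - B) < delta by rewrite -hsnormN opprB /P fjk; exact: hf.
apply: le_lt_trans (hsnormD_sqr (A - P) (P - B)) _.
by move: (hsnorm _ ^+ 2) (hsnorm _ ^+ 2) hA hB => a b; lra.
Qed.

(** A finite supremum of cardinalities is attained, and a packing of maximal size is a covering at
    the same scale: an uncovered point could be added to it. *)
Lemma packing_max d (F : set 'M[C]_d) (delta : R) : 0 < delta ->
  (packing F delta < +oo)%E ->
  exists s : seq 'M[C]_d, packing F delta = (size s)%:R%:E /\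
    forall A, F A -> exists2 B, B \in s & hsnorm (A - B) < delta.
Proof.
move=> delta0 pfin.
pose Q (s : seq 'M[C]_d) := uniq s /\ (forall A, A \in s -> F A) /\
  (forall A B, A \in s -> B \in s -> A != B -> delta <= hsnorm (A - B)).
have Qle s : Q s -> ((size s)%:R%:E <= packing F delta)%E.
  by move=> Qs; apply: ereal_sup_ubound; exists s.
have Q0 : Q [::] by [].
have pE : packing F delta = (fine (packing F delta))%:E.
  rewrite fineK // fin_numElt pfin andbT.
  by apply: lt_le_trans (Qle _ Q0); rewrite ltNyr.
pose P m := `[< exists s, Q s /\ size s = m >].
have exP : exists m, P m by exists 0%N; apply/asboolP; exists [::].
have ubP m : P m -> (m <= Num.truncn (fine (packing F delta)))%N.
  move=> /asboolP[s [Qs <-]]; have := Qle _ Qs; rewrite pE lee_fin => h.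
  by rewrite truncn_ge_nat // (le_trans _ h).
case: (ex_maxnP exP ubP) => m /asboolP[s [Qs sm]] maxm; exists s; split.
  apply/eqP; rewrite eq_le Qle // andbT; apply: ge_ereal_sup => _ [t Qt <-].
  by rewrite lee_fin ler_nat sm maxm //; apply/asboolP; exists t.
move=> A FA; have [As|As] := boolP (A \in s).
  by exists A => //; rewrite subrr hsnorm0.
apply: contrapT => nB.
have far B : B \in s -> delta <= hsnorm (A - B).
  by move=> Bs; rewrite leNgt; apply/negP => h; apply: nB; exists B.
suff : P m.+1 by move=> /maxm; rewrite ltnn.
case: Qs => us [sF ss]; apply/asboolP; exists (A :: s); split; last by rewrite /= sm.
split; first by rewrite /= As.
split=> [B|B D]; first by rewrite in_cons => /orP[/eqP->|/sF].
rewrite !in_cons => /orP[/eqP->|Bs] /orP[/eqP->|Ds] BD.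
- by rewrite eqxx in BD.
- exact: far.
- by rewrite -hsnormN opprB; exact: far.
- exact: ss.
Qed.

(** * Extended logarithms and lower limits *)

Lemma le_elog2 (x y : \bar R) : (x <= y)%E -> (elog2 x <= elog2 y)%E.
Proof.
case: x y => [x| |] [y| |] // xy; rewrite /= ?leey ?leNye //.
rewrite lee_fin in xy; case: ifP => x0; last by rewrite leNye.
rewrite (lt_le_trans x0 xy) lee_fin ler_pM2r ?invr_gt0 ?ln_gt0 ?ltr1n //.
by rewrite ler_ln ?posrE // (lt_le_trans x0 xy).
Qed.

Lemma lt_elog2 (y : R) (x : \bar R) : (y%:E < elog2 x)%E -> ((expR (y * ln 2))%:E < x)%E.
Proof.
case: x => [x| |] //=; rewrite ?ltry //.
case: ifP => // x0; rewrite !lte_fin /log2 ltr_pdivlMr ?ln_gt0 ?ltr1n // => h.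
by rewrite -(@lnK _ x) ?posrE // ltr_expR.
Qed.

Lemma ereal_between_lt (r : R) (x : \bar R) : (r%:E < x)%E ->
  exists2 a : R, r < a & (a%:E < x)%E.
Proof.
case: x => [x| |] //; last by exists (r + 1); rewrite ?ltrDl ?ltry.
by rewrite lte_fin => rx; exists ((r + x) / 2); rewrite ?lte_fin; lra.
Qed.

Lemma ereal_between_gt (r : R) (x : \bar R) : (x < r%:E)%E ->
  exists2 a : R, a < r & (x < a%:E)%E.
Proof.
case: x => [x| |] //; last by exists (r - 1); rewrite ?ltrBlDr ?ltrDl ?ltNyr.
by rewrite lte_fin => rx; exists ((r + x) / 2); rewrite ?lte_fin; lra.
Qed.

(** Reduces bounds between possibly infinite quantities to real thresholds, whose strictness gives
    the slack that absorbs lower-order terms. *)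
Lemma ereal_le_from_below (x y : \bar R) :
  (forall r : R, (r%:E < x)%E -> (r%:E <= y)%E) -> (x <= y)%E.
Proof.
move=> H; rewrite leNgt; apply/negP => yx.
case: y H yx => [y| |] H yx.
- by have [a ya /H] := ereal_between_lt yx; rewrite lee_fin leNgt ya.
- by rewrite ltNge leey in yx.
- case: x H yx => [x| |] H // _.
    by have := H (x - 1); rewrite lte_fin ltrBlDr ltrDl => /(_ ltr01).
  by have := H 0; rewrite ltry => /(_ isT).
Qed.

Lemma ereal_le_from_above (x y : \bar R) :
  (forall r : R, (y < r%:E)%E -> (x <= r%:E)%E) -> (x <= y)%E.
Proof.
move=> H; rewrite -leeN2; apply: ereal_le_from_below => r.
by rewrite lteNr leeNr -EFinN => /H.
Qed.

Lemma le_limn_einf (u : nat -> \bar R) (r : \bar R) :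
  (\forall n \near \oo, (r <= u n)%E) -> (r <= limn_einf u)%E.
Proof.
move=> H; rewrite -[limn_einf u]/(limf_einf u \oo) limf_einfE.
apply: le_trans (ereal_sup_ubound _); last by exists [set n | (r <= u n)%E].
by apply: le_ereal_inf_tmp => _ [n /= ? <-].
Qed.

(** Arbitrarily large n suffice, as the converse requires: a lower dimension controls packings only
    along a sequence of scales. *)
Lemma limn_einf_le (u : nat -> \bar R) (r : \bar R) :
  (forall N, exists2 n, (N <= n)%N & (u n <= r)%E) -> (limn_einf u <= r)%E.
Proof.
move=> H; rewrite -[limn_einf u]/(limf_einf u \oo) limf_einfE.
apply: ge_ereal_sup => _ [V [N _ NV] <-]; have [n Nn un] := H N.
by apply: le_trans un; apply: ereal_inf_lbound; exists n => //; exact: NV.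
Qed.

Lemma lt_limf_einf (f : R -> \bar R) (r : \bar R) :
  (r < limf_einf f ((0 : R)^'+))%E ->
  exists2 eta : R, 0 < eta & forall x, 0 < x < eta -> (r < f x)%E.
Proof.
rewrite limf_einfE => /ereal_sup_gt[_ [V [eta /= eta0 hV] <-] h].
exists eta => // x /andP[x0 xeta]; apply: lt_le_trans h _.
apply: ereal_inf_lbound; exists x => //; apply: hV => //=.
by rewrite sub0r normrN gtr0_norm.
Qed.

Lemma limf_einf_lt (f : R -> \bar R) (r : \bar R) (eta : R) : 0 < eta ->
  (limf_einf f ((0 : R)^'+) < r)%E -> exists2 x, 0 < x < eta & (f x < r)%E.
Proof.
move=> eta0; rewrite limf_einfE => h.
have : (ereal_inf (f @` [set x : R | (0 < x < eta)%R]) < r)%E.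
  apply: le_lt_trans h; apply: ereal_sup_ubound; exists [set x : R | (0 < x < eta)%R] => //.
  exists eta => //= x; rewrite /= sub0r normrN => xeta x0.
  by rewrite x0 (le_lt_trans (ler_norm x)).
by move=> /ereal_inf_lt[_ [x ? <-]]; exists x.
Qed.

End Converse.

(** * Capacity bounds *)

Section Capacity.
Variable R : realType.
Local Notation C := R[i].

Let ln2_gt0 : 0 < ln 2 :> R.
Proof. by rewrite ln_gt0 // ltr1n. Qed.

Lemma nat_log2_gt0 n : (1 < n)%N -> 0 < n%:R * log2 n%:R :> R.
Proof.
move=> n1; rewrite mulr_gt0 ?ltr0n ?(ltnW n1) // /log2 divr_gt0 //.
by rewrite ln_gt0 // ltr1n.
Qed.

(** The base of the logarithms cancels in the quotient. A finite packing above the threshold exists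
    even if the packing number is infinite. *)
Lemma packing_exponent_lower d (F : set 'M[C]_d) (a delta : R) : 0 < delta < 1 ->
  (a%:E < elog2 (packing F delta) * ((- log2 delta)^-1)%:E)%E ->
  exists s : seq 'M[C]_d, [/\ uniq s, forall A, A \in s -> F A,
    forall A B, A \in s -> B \in s -> A != B -> delta <= hsnorm (A - B),
    (0 < size s)%N & a * - ln delta <= ln (size s)%:R].
Proof.
move=> /andP[d0 d1].
have L0 : 0 < - log2 delta by rewrite /log2 -mulNr divr_gt0 // oppr_gt0 ln_lt0 // d0.
rewrite lte_pdivlMr // -EFinM => /lt_elog2/ereal_sup_gt[_ [s [us [sF ss]] <-]].
rewrite lte_fin /log2 mulrN mulNr -mulrA divfK ?gt_eqF // => h.
have s0 : 0 < (size s)%:R :> R by apply: lt_trans h; rewrite expR_gt0.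
exists s; split=> //; first by rewrite -(ltr0n R).
by rewrite mulrN -[X in X <= _]expRK ler_ln ?posrE ?expR_gt0 // ltW.
Qed.

(** A real r below a quarter of the dimension leaves room for an exponent a > 4 r, and packings of
    that exponent exist at every small scale, so codes exist for every large n. *)
Lemma DI_rate_ge_dim X d (W : X -> 'M[C]_d) (l1 l2 : R) :
  (forall x, density (W x)) -> 0 < l1 -> 0 < l2 ->
  ((1 / 4)%:E * lower_dimM [set mxsqrt S | S in range W] <= DI_rate W l1 l2)%E.
Proof.
move=> HW hl1 hl2; apply: ereal_le_from_below => r.
rewrite div1r muleC lte_pdivlMr // -EFinM => /ereal_between_lt[a ra].
move=> /lt_limf_einf[eta eta0 heta].
(* Gives th a <= (a - 4 r) / 2, hence 4 r < (1 - th) a; the absolute value covers negative [a]. *)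
pose th := Num.min (1 / 2) ((a - r * 4) / (2 * (`|a| + 1))).
have a1 : 0 < `|a| + 1 by rewrite ltr_wpDl.
have th0 : 0 < th by rewrite lt_min !divr_gt0 ?mulr_gt0 ?subr_gt0.
have th1 : th <= 1 / 2 by rewrite ge_min lexx.
have tha : th * (2 * (`|a| + 1)) <= a - r * 4.
  by rewrite -ler_pdivlMr ?mulr_gt0 // ge_min lexx orbT.
have hr : r < (1 - th) * a / 4.
  have := ler_norm a; have := normr_ge0 a; nra.
have H := @DI_code_rate R X d W l1 l2 a th r (Num.min eta 1) HW hl1 hl2 _ _ hr _.
apply: le_limn_einf; near=> n.
have n1 : (1 < n)%N by near: n; exact: nbhs_infty_gt.
have [N [u [E [hcode N0 hN]]]] : exists N u E, [/\ @is_DI_code R X d W n N l1 l2 u E,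
    (0 < N)%N & r * (n%:R * ln n%:R) <= ln N%:R].
  near: n; apply: H; first by rewrite th0 (le_lt_trans th1) // ltr_pdivrMr //; lra.
    by rewrite lt_min eta0 ltr01.
  move=> delta /andP[d0]; rewrite lt_min => /andP[deta d1].
  have [||s [us sF ss s0 hs]] := @packing_exponent_lower d
    [set mxsqrt S | S in range W] a delta; first by rewrite d0.
    by apply: heta; rewrite d0.
  have /choice[x hx] : forall i : 'I_(size s), exists x, mxsqrt (W x) = nth 0 s i.
    by move=> i; have [|_ [x _ <-] <-] := sF (nth 0 s i); [exact: mem_nth | exists x].
  exists (size s), x; split=> // i j ij; rewrite !hx.
  rewrite ler_pXn2r ?nnegrE ?sqrtr_ge0 ?(ltW d0) //.
  by apply: ss; rewrite ?mem_nth ?nth_uniq.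
have nn0 := nat_log2_gt0 n1.
apply: le_trans (_ : _ <= ((n%:R * log2 n%:R)^-1)%:E * (log2 N%:R)%:E)%E _.
  rewrite -EFinM lee_fin mulrC ler_pdivlMr // /log2 mulrA [in X in X <= _]mulrA.
  by rewrite ler_pM2r ?invr_gt0 // -mulrA.
apply: lee_wpmul2l; first by rewrite lee_fin invr_ge0 ltW.
have -> : (log2 N%:R)%:E = elog2 (N%:R%:E) :> \bar R by rewrite /= ltr0n N0.
by apply: le_elog2; apply: ereal_sup_ubound; exists N => //; exists u, E.
Unshelve. all: by end_near. Qed.

(** For r above half the dimension there are b < 2 r and arbitrarily small scales with packing
    exponent below [b]; each scale determines a block length n of order delta^(-2), and - ln delta
    is then about (ln n) / 2. *)
Lemma DI_rate_le_dim X d (W : X -> 'M[C]_d) (l1 l2 : R) :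
  (forall x, density (W x)) -> l1 + l2 < 1 ->
  (DI_rate W l1 l2 <= (1 / 2)%:E * lower_dimM [set mxsqrt S | S in range W])%E.
Proof.
move=> HW hl; set F := [set mxsqrt S | S in range W].
apply: ereal_le_from_above => r.
rewrite div1r muleC lte_pdivrMr // -EFinM => /ereal_between_gt[b br hb].
apply: limn_einf_le => N0.
pose e := 1 - l1 - l2; have e0 : 0 < e by rewrite /e; lra.
pose kp := e / 2 / (1 + 2 / e).
have kp0 : 0 < kp by rewrite !divr_gt0 // addr_gt0 ?divr_gt0.
pose g := r - b / 2; have g0 : 0 < g by rewrite /g; lra.
pose B := b / 2 * (1 + ln (4 / kp)).
have [N1 _ hN1] : \forall n \near \oo, B / g <= ln n%:R := near_ln_ge _.
pose N2 := maxn (maxn N0 N1) 2.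
(* Since delta < 1, delta^2 <= delta < eta, which forces the block length below to be at least
   [N2]. *)
pose eta := Num.min 1 (kp / (4 * N2.+1%:R)).
have eta0 : 0 < eta by rewrite lt_min ltr01 divr_gt0 // mulr_gt0 ?ltr0n.
have [delta /andP[d0]] := limf_einf_lt eta0 hb.
rewrite lt_min => /andP[d1 deta] hdelta.
have dd0 : 0 < 4 * delta ^+ 2 by rewrite mulr_gt0 // exprn_gt0.
(* The largest n with 4 delta^2 n <= kp, the condition under which rounding is injective on
   codewords. *)
pose n := Num.truncn (kp / (4 * delta ^+ 2)).
have /andP[nle nlt] := truncn_itv (ltW (divr_gt0 kp0 dd0)); rewrite -/n in nle nlt.
have nN2 : (N2 <= n)%N.
  rewrite truncn_ge_nat; last exact: ltW (divr_gt0 kp0 dd0).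
  rewrite ler_pdivlMr //.
  move: deta; rewrite ltr_pdivlMr ?mulr_gt0 ?ltr0n // -natr1 => deta.
  have : delta ^+ 2 <= delta by rewrite expr2 ler_piMl // ltW.
  have := ler0n R N2; nra.
have n1 : (1 < n)%N by apply: leq_trans nN2; rewrite leq_maxr.
have nN1 : (N1 <= n)%N by apply: leq_trans nN2; rewrite !leq_max leqnn orbT.
have nN0 : (N0 <= n)%N by apply: leq_trans nN2; rewrite !leq_max leqnn.
have n0 : (0 < n)%N by exact: ltnW.
exists n => //.
have L0 : 0 < - log2 delta by rewrite /log2 -mulNr divr_gt0 // oppr_gt0 ln_lt0 // d0.
move: hdelta; rewrite lte_pdivrMr // -EFinM => hdelta.
have pfin : (packing F delta < +oo)%E.
  by rewrite ltey; apply/eqP => pE; rewrite pE in hdelta.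
have [s [ps cover]] := packing_max d0 pfin.
have NDI : (N_DI W n l1 l2 <= ((size s ^ n)%:R)%:E)%E.
  apply: ge_ereal_sup => _ [N [u [E hcode]] <-]; rewrite lee_fin ler_nat.
  apply: (DI_code_size HW (erefl : e = 1 - l1 - l2) e0 n0 hcode (delta := delta)).
    by rewrite -ler_pdivlMl // mulrC.
  by move=> x; apply: cover; exists (W x) => //; exists x.
have nn0 := nat_log2_gt0 n1.
apply: (@le_trans _ _ (((n%:R * log2 n%:R)^-1)%:E * elog2 (((size s ^ n)%:R)%:E : \bar R))%E).
  by apply: lee_wpmul2l; [rewrite lee_fin invr_ge0 ltW | exact: le_elog2].
(* An empty packing bounds the code size by 0, and the rate at this n is -oo. *)
have [s0|s0] := posnP (size s).
  rewrite s0 exp0n //= ltxx.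
  by rewrite gt0_muleNy ?leNye // lte_fin invr_gt0.
rewrite ps /= ltr0n s0 lte_fin in hdelta.
rewrite /= ltr0n expn_gt0 s0 /= -EFinM lee_fin mulrC ler_pdivrMr //.
rewrite /log2 natrX lnXn ?ltr0n // -[ln _ *+ n]mulr_natl !mulrA ler_pM2r ?invr_gt0 //.
rewrite [r * _]mulrC -mulrA ler_pM2l ?ltr0n //.
have hm : ln (size s)%:R <= b * - ln delta.
  move: hdelta; rewrite /log2 ltr_pdivrMr // mulrN mulNr -mulrA divfK ?gt_eqF //.
  by rewrite mulrN => /ltW.
have ld : 0 < - ln delta by rewrite oppr_gt0 ln_lt0 // d0.
have lm : 0 <= ln (size s)%:R :> R by rewrite ln_ge0 // ler1n.
(* A nonempty packing has nonnegative exponent, so [b] may multiply the upper bound on - ln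
   delta. *)
have b0 : 0 <= b by rewrite -(pmulr_lge0 _ ld); exact: le_trans hm.
apply: le_trans hm _.
(* Maximality of n gives delta^(-2) < (n + 1) (4 / kp), and ln (n + 1) <= ln n + 1. *)
have hl1 : - ln delta <= (ln n%:R + 1 + ln (4 / kp)) / 2.
  have kp4 : 0 < 4 / kp by exact: divr_gt0.
  have : ln (delta ^+ 2)^-1 <= ln (n.+1%:R * (4 / kp)).
    have nkp : 0 < n.+1%:R * (4 / kp) by rewrite mulr_gt0 ?ltr0n.
    rewrite ler_ln ?posrE ?invr_gt0 ?exprn_gt0 //.
    move: nlt; rewrite ltr_pdivrMr // => nlt.
    rewrite -[X in X <= _]mul1r ler_pdivrMr ?exprn_gt0 // mulrA mulrAC ler_pdivlMr // mul1r.
    by rewrite -mulrA ltW.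
  rewrite lnV ?posrE ?exprn_gt0 // lnXn // lnM ?posrE ?ltr0n //.
  have -> : n.+1%:R = n%:R * (1 + n%:R^-1) :> R.
    by rewrite mulrDr divff ?mulr1 ?natr1 // pnatr_eq0 -lt0n.
  rewrite lnM ?posrE ?ltr0n // ?addr_gt0 ?invr_gt0 ?ltr0n //.
  have : ln (1 + n%:R^-1) <= n%:R^-1 :> R.
    by apply: le_ln1Dx; rewrite (lt_trans (ltrN10 R)) // invr_gt0 ltr0n.
  have : n%:R^-1 <= 1 :> R by rewrite invf_le1 ?ltr0n // ler1n.
  rewrite -[ln delta *+ 2]mulr_natr; lra.
apply: le_trans (ler_wpM2l b0 hl1) _.
have := hN1 n nN1; rewrite /= ler_pdivrMr // /B /g; nra.
Qed.

End Capacity.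

Theorem theorem3 (R : realType) (d : nat) (X : Type) (W : X -> 'M[R[i]]_d)
    (HW : forall x, density (W x))
    (l1 l2 : R) (hl1 : 0 < l1) (hl2 : 0 < l2) (hl12 : l1 + l2 < 1) :
  let sqrtX := [set mxsqrt S | S in range W] in
  ((1 / 4)%:E * lower_dimM sqrtX <= C_DI W)%E /\
  (C_DI W <= DI_rate W l1 l2)%E /\
  (DI_rate W l1 l2 <= (1 / 2)%:E * lower_dimM sqrtX)%E.
Proof.
move=> sqrtX; split; last split.
(* The lower bound holds for every pair of positive errors, so it passes to the infimum. *)
- by apply: le_ereal_inf_tmp => _ [[k1 k2] /= [k10 k20] <-]; exact: DI_rate_ge_dim.
- by apply: ereal_inf_lbound; exists (l1, l2).
- exact: DI_rate_le_dim.
Qed.
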